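(* Let $A,B\subseteq\omega$ such that $A$ has intrinsic density $\alpha$ and $B$ has $A$-intrinsic density $\beta$. Then $B\triangleright A$ has intrinsic density $\alpha\beta$.
   Context: For $S\subseteq\omega$ write $S=\{s_0<s_1<s_2<\cdots\}$ (with $s_n$ defined for $n<|S|$). $B\triangleright A=\{a_{b_n}: n\in\omega,\ a_{b_n}\text{ defined}\}$, the elements of $A$ whose index in increasing order lies in $B$. $\rho_n(S)=|S\cap\{0,\dots,n-1\}|/n$, $\rho(S)=\lim_n\rho_n(S)$ when it exists. $S$ has intrinsic density $\gamma$ if $\rho(\pi(S))=\gamma$ for every computable permutation $\pi$ of $\omega$; $S$ has $Y$-intrinsic density $\gamma$ if $\rho(\pi(S))=\gamma$ for every $Y$-computable permutation $\pi$ of $\omega$. *)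

(* Defs.v *)
From mathcomp Require Import all_boot all_order all_algebra.
From mathcomp Require Import all_classical all_reals all_analysis.

Set Implicit Arguments.
Unset Strict Implicit.
Unset Printing Implicit Defensive.

Import Order.TTheory GRing.Theory Num.Theory.
Import numFieldNormedType.Exports.

Local Open Scope classical_set_scope.
Local Open Scope ring_scope.

(** Kleene's mu-recursive programs of arity [n], with a symbol [Orc] for the
    characteristic function of an oracle. [Rec] recurses on the first argument;
    [Mu] searches for the least first argument giving 0. *)
Inductive prog : nat -> Type :=
| Zero n : prog n
| Succ : prog 1
| Proj n (i : 'I_n) : prog n
| Orc : prog 1
| Comp m n (f : prog m) (g : 'I_m -> prog n) : prog n
| Rec n (f : prog n) (g : prog n.+2) : prog n.+1
| Mu n (f : prog n.+1) : prog n.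

(** [prog_eval Y p v y]: with oracle [Y], the program [p] halts on input [v] with
    output [y]. In the case of [Rec], [s] lists the successive values. *)
Fixpoint prog_eval (Y : set nat) n (p : prog n) : n.-tuple nat -> nat -> Prop :=
  match p in prog n return n.-tuple nat -> nat -> Prop with
  | Zero _ => fun _ y => y = 0%N
  | Succ => fun v y => y = (thead v).+1
  | Proj _ i => fun v y => y = tnth v i
  | Orc => fun v y => y = (thead v \in Y)
  | Comp m _ f g => fun v y =>
      exists2 w : m.-tuple nat,
        forall i, prog_eval Y (g i) v (tnth w i) & prog_eval Y f w y
  | Rec _ f g => fun v y =>
      let k := thead v in
      let u := behead_tuple v in
      exists s : nat -> nat,
        [/\ prog_eval Y f u (s 0%N),
            forall i, (i < k)%N -> prog_eval Y g [tuple of i :: s i :: u] (s i.+1)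
          & y = s k]
  | Mu _ f => fun v y =>
      prog_eval Y f [tuple of y :: v] 0%N /\
      forall z, (z < y)%N -> exists x, prog_eval Y f [tuple of z :: v] x.+1
  end.

Fixpoint oracle_free n (p : prog n) : Prop :=
  match p with
  | Orc => False
  | Comp _ _ f g => oracle_free f /\ forall i, oracle_free (g i)
  | Rec _ f g => oracle_free f /\ oracle_free g
  | Mu _ f => oracle_free f
  | _ => True
  end.

Definition computable_in (Y : set nat) (f : nat -> nat) : Prop :=
  exists p : prog 1, forall k, prog_eval Y p [tuple k] (f k).

(** The oracle [set0] is immaterial, as it is never queried. *)
Definition computable (f : nat -> nat) : Prop :=
  exists2 p : prog 1, oracle_free p & forall k, prog_eval set0 p [tuple k] (f k).

Definition count_below (S : set nat) (n : nat) : nat :=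
  count (fun i => i \in S) (iota 0 n).

(** [x] is the element [s_n] of [S = {s_0 < s_1 < ...}]. *)
Definition is_nth_elt (S : set nat) (n x : nat) : Prop :=
  S x /\ count_below S x = n.

(** [B ▷ A = {a_(b_n)}]. *)
Definition triangle (B A : set nat) : set nat :=
  [set x | exists n b, is_nth_elt B n b /\ is_nth_elt A b x].

Notation "B ▷ A" := (triangle B A) (at level 52, left associativity).

Definition has_density (R : realType) (S : set nat) (gamma : R) : Prop :=
  (count_below S n)%:R / n%:R @[n --> \oo] --> gamma.

Definition has_intrinsic_density (R : realType) (S : set nat) (gamma : R) :
    Prop :=
  forall pi : nat -> nat, bijective pi -> computable pi ->
    has_density (pi @` S) gamma.

Definition has_rel_intrinsic_density (R : realType) (Y S : set nat)
    (gamma : R) : Prop :=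
  forall pi : nat -> nat, bijective pi -> computable_in Y pi ->
    has_density (pi @` S) gamma.

(* Main.v *)
Require Import Defs.
From mathcomp Require Import all_boot all_order all_algebra.
From mathcomp Require Import all_classical all_reals all_analysis.

(** Put [S = pi @` A] and let [sigma n] be the rank in [S] of the image under
    [pi] of the [n]-th element of [A]. When [A] and [S] are infinite, [sigma] is
    an [A]-computable permutation and [pi @` (B ▷ A) = (sigma @` B) ▷ S]. Since
    [count_below (C ▷ S) n = count_below C (count_below S n)], the density of
    this set is the product of the densities of [sigma @` B] and of [S]. When
    [A] or [S] is finite, [alpha = 0] and [B ▷ A] is contained in [A]. *)

Set Implicit Arguments.
Unset Strict Implicit.
Unset Printing Implicit Defensive.

Import Order.TTheory GRing.Theory Num.Theory.
Import numFieldNormedType.Exports.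

Local Open Scope classical_set_scope.

(** * Relative computability *)

(** Recursion and search change the arity, so closure properties are proved for total functions of
    any number of arguments; [computable_inP] returns to one argument. *)
Definition tuple_computable (Y : set nat) n (F : n.-tuple nat -> nat) : Prop :=
  exists p : prog n, forall v, prog_eval Y p v (F v).

(** Induction on the program: only [Orc] consults the oracle, and it is excluded. *)
Lemma prog_eval_oracle_free (Y Z : set nat) n (p : prog n) v y :
  oracle_free p -> prog_eval Y p v y -> prog_eval Z p v y.
Proof.
elim: p v y => //=.
- move=> m k f IHf g IHg v y [of_f of_g] [w gw fw].
  by exists w; [move=> i; apply: IHg | apply: IHf].
- move=> k f IHf g IHg v y [of_f of_g] [s [s0 sS ->]].
  exists s; split=> //; first exact: IHf.
  by move=> i ik; apply: IHg => //; apply: sS.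
- move=> k f IHf v y of_f [fy fz]; split; first exact: IHf.
  by move=> z /fz[x fx]; exists x; apply: IHf.
Qed.

Lemma computable_computable_in Y f : computable f -> computable_in Y f.
Proof.
by move=> [p of_p pf]; exists p => k; exact: prog_eval_oracle_free (pf k).
Qed.

Lemma tuple1E (v : 1.-tuple nat) : v = [tuple thead v].
Proof. by apply: val_inj; case: v => -[|x [|]]. Qed.

Lemma computable_inP Y f :
  computable_in Y f <-> tuple_computable Y (fun v : 1.-tuple nat => f (thead v)).
Proof.
split=> -[p pf]; exists p => v; last exact: pf.
by rewrite [v in prog_eval _ _ v]tuple1E.
Qed.

Lemma computable_id : computable id.
Proof. by exists (Proj ord0) => // k. Qed.

Lemma count_belowS (S : set nat) n :
  count_below S n.+1 = (count_below S n + (n \in S))%N.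
Proof. by rewrite /count_below -addn1 iotaD count_cat /= add0n addn0. Qed.

Lemma leq_count_below (S : set nat) : {homo count_below S : m n / (m <= n)%N}.
Proof.
by move=> m n mn; rewrite /count_below -(subnKC mn) iotaD count_cat leq_addr.
Qed.

Section TupleComputable.
Variable Y : set nat.

Lemma tuple_computable_ext n (F G : n.-tuple nat -> nat) :
  F =1 G -> tuple_computable Y F -> tuple_computable Y G.
Proof. by move=> /funext->. Qed.

Lemma tuple_computable_proj n (i : 'I_n) :
  tuple_computable Y (fun v => tnth v i).
Proof. by exists (Proj i). Qed.

Lemma tuple_computable_comp1 n f (G : n.-tuple nat -> nat) :
  computable_in Y f -> tuple_computable Y G ->
  tuple_computable Y (fun v => f (G v)).
Proof.
move=> [p pf] [q qG]; exists (Comp p (fun=> q)) => v /=.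
by exists [tuple G v] => // i; rewrite ord1.
Qed.

Lemma tuple_computable_comp2 n (f : nat -> nat -> nat)
    (G H : n.-tuple nat -> nat) :
  tuple_computable Y (fun v : 2.-tuple nat => f (tnth v ord0) (tnth v ord_max)) ->
  tuple_computable Y G -> tuple_computable Y H ->
  tuple_computable Y (fun v => f (G v) (H v)).
Proof.
move=> [p pf] [q qG] [r rH].
exists (Comp p (fun i => if i == ord0 then q else r)) => v /=.
exists [tuple G v; H v]; last exact: (pf [tuple G v; H v]).
by case=> [[|[|]]].
Qed.

(** The tuple given to [g] consists of the index, the previous value and the parameters. With the
    parameters fixed, [s] is the sequence of values that [Rec] asks for. *)
Lemma tuple_computable_rec n (s : nat -> n.-tuple nat -> nat) g :
  tuple_computable Y (s 0%N) -> tuple_computable Y g ->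
  (forall i u, s i.+1 u = g [tuple of i :: s i u :: u]) ->
  tuple_computable Y (fun v => s (thead v) (behead_tuple v)).
Proof.
move=> [p p0] [q qg] sS; exists (Rec p q) => v /=.
by exists (s ^~ (behead_tuple v)); split=> // i _; rewrite sS.
Qed.

Lemma tuple_computable_mu n (f : n.+1.-tuple nat -> nat) (m : n.-tuple nat -> nat) :
  tuple_computable Y f ->
  (forall v, f [tuple of m v :: v] = 0%N) ->
  (forall v z, (z < m v)%N -> f [tuple of z :: v] <> 0%N) ->
  tuple_computable Y m.
Proof.
move=> [p pf] fm fz; exists (Mu p) => v /=.
split=> [|z /fz]; first by rewrite -(fm v).
by have := pf [tuple of z :: v]; case: (f _) => // x px _; exists x.
Qed.

Lemma computable_in_succ : computable_in Y succn.
Proof. by exists Succ. Qed.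

Lemma computable_in_mem : computable_in Y (fun x => x \in Y).
Proof. by exists Orc. Qed.

Lemma computable_in_pred : computable_in Y predn.
Proof.
apply/computable_inP.
(* The recursion step returns its index [i], the predecessor of [i.+1]. *)
apply: (@tuple_computable_rec 0 (fun k _ => k.-1) (fun w => tnth w ord0)) => //.
- by exists (Zero 0).
- exact: tuple_computable_proj.
Qed.

Lemma thead_behead2 (v : 2.-tuple nat) : thead (behead_tuple v) = tnth v ord_max.
Proof. by rewrite /thead !(tnth_nth 0%N) nth_behead. Qed.

Lemma tuple_computable_add :
  tuple_computable Y (fun v : 2.-tuple nat => tnth v ord0 + tnth v ord_max)%N.
Proof.
have := @tuple_computable_rec 1 (fun k u => k + thead u)%N
  (fun w => (tnth w (lift ord0 ord0)).+1).
move=> H; apply: (tuple_computable_ext _ (H _ _ _)) => //.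
- by move=> v; rewrite thead_behead2.
- exact: tuple_computable_proj.
- exact/tuple_computable_comp1/tuple_computable_proj/computable_in_succ.
Qed.

Lemma tuple_computable_sub :
  tuple_computable Y (fun v : 2.-tuple nat => tnth v ord0 - tnth v ord_max)%N.
Proof.
(* Iterating the predecessor is a recursion on the subtrahend, which must therefore come first. *)
suff H : tuple_computable Y (fun v : 2.-tuple nat => tnth v ord_max - tnth v ord0)%N.
  exact: (@tuple_computable_comp2 _ (fun x y => y - x)%N _ _ H
    (tuple_computable_proj _) (tuple_computable_proj _)).
have := @tuple_computable_rec 1 (fun k u => thead u - k)%N
  (fun w => (tnth w (lift ord0 ord0)).-1).
move=> H; apply: (tuple_computable_ext _ (H _ _ _)) => //.
- by move=> v; rewrite thead_behead2.
- by apply: (tuple_computable_ext _ (tuple_computable_proj ord0)) => u; rewrite subn0.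
- exact/tuple_computable_comp1/tuple_computable_proj/computable_in_pred.
- by move=> i u; rewrite subnS.
Qed.

Lemma computable_in_comp f g :
  computable_in Y f -> computable_in Y g -> computable_in Y (f \o g).
Proof.
move=> cf /computable_inP cg; apply/computable_inP.
exact: (tuple_computable_comp1 cf cg).
Qed.

Lemma computable_in_count_below (S : set nat) :
  computable_in Y (fun x => x \in S) -> computable_in Y (count_below S).
Proof.
move=> cS; apply/computable_inP.
apply: (@tuple_computable_rec 0 (fun k _ => count_below S k)
  (fun w => tnth w ord_max + (tnth w ord0 \in S))%N).
- by exists (Zero 0).
- apply: (@tuple_computable_comp2 _ addn _ (fun w => (tnth w ord0 \in S) : nat)).
  + exact: tuple_computable_add.
  + exact: tuple_computable_proj.
  + exact: (tuple_computable_comp1 cS (tuple_computable_proj _)).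
- by move=> i u; rewrite count_belowS.
Qed.

(** Search for the [z] with [f z = x]: the sum of the two truncated differences is the distance from
    [f z] to [x], and injectivity of [f] excludes a smaller zero. *)
Lemma computable_in_inv f g :
  cancel f g -> cancel g f -> computable_in Y f -> computable_in Y g.
Proof.
move=> fK gK cf; apply/computable_inP.
apply: (@tuple_computable_mu _ (fun w =>
   (f (tnth w ord0) - tnth w ord_max) + (tnth w ord_max - f (tnth w ord0)))%N).
- have c0 := tuple_computable_comp1 cf (@tuple_computable_proj 2 ord0).
  have c1 := @tuple_computable_proj 2 ord_max.
  apply: (tuple_computable_comp2 tuple_computable_add).
  + exact: (tuple_computable_comp2 tuple_computable_sub).
  + exact: (tuple_computable_comp2 tuple_computable_sub).
- by move=> v; rewrite (tnth_nth 0%N) [tnth _ ord_max](tnth_nth 0%N) /= gK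
    /thead (tnth_nth 0%N) subnn.
- move=> v z; rewrite (tnth_nth 0%N) [tnth _ ord_max](tnth_nth 0%N) /=
    /thead (tnth_nth 0%N) /= => zg /eqP.
  rewrite addn_eq0 !subn_eq0 -eqn_leq => /eqP fz.
  by move: zg; rewrite -fz fK ltnn.
Qed.

(** [a n] is the least [z] such that more than [n] elements of [S] are at most [z]. *)
Lemma computable_in_nth_elt (S : set nat) a :
  computable_in Y (fun x => x \in S) -> (forall n, is_nth_elt S n (a n)) ->
  computable_in Y a.
Proof.
move=> cS Sa; apply/computable_inP.
apply: (@tuple_computable_mu _ (fun w =>
   ((tnth w ord_max).+1 - count_below S (tnth w ord0).+1))%N).
- apply: (tuple_computable_comp2 tuple_computable_sub).
  + exact/tuple_computable_comp1/tuple_computable_proj/computable_in_succ.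
  + apply: (tuple_computable_comp1 (computable_in_count_below cS)).
    exact/tuple_computable_comp1/tuple_computable_proj/computable_in_succ.
- move=> v; rewrite (tnth_nth 0%N) [tnth _ ord0](tnth_nth 0%N) /= /thead (tnth_nth 0%N).
  have [Sx cx] := Sa (nth 0%N v 0).
  by rewrite count_belowS cx mem_set // addn1 subnn.
- move=> v z; rewrite (tnth_nth 0%N) [tnth _ ord0](tnth_nth 0%N) /=
    /thead (tnth_nth 0%N) /= => za /eqP.
  have [_ cx] := Sa (nth 0%N v 0).
  rewrite subn_eq0 -{1}cx ltnNge => /negP; apply.
  exact: leq_count_below.
Qed.

End TupleComputable.

(** * Counting and density *)

Lemma subset_count_below (S T : set nat) n :
  S `<=` T -> (count_below S n <= count_below T n)%N.
Proof.
by move=> ST; apply: sub_count => x; rewrite !inE => /ST.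
Qed.

(** Passing an element raises the count, so two elements [x < y] cannot have equal counts. *)
Lemma is_nth_elt_uniq (S : set nat) n x y :
  is_nth_elt S n x -> is_nth_elt S n y -> x = y.
Proof.
wlog xy : x y / (x <= y)%N => [H Sx Sy|].
  by have /orP[/H|/H H'] := leq_total x y; [exact | exact/esym/H'].
move=> [Sx cx] [_ cy]; move: xy; rewrite leq_eqVlt => /orP[/eqP//|].
by move=> /(@leq_count_below S); rewrite count_belowS cx cy mem_set // addn1 ltnn.
Qed.

(** The least bound whose count exceeds [n] is the successor of the element sought, since the count
    first rises from [n] to [n.+1] there. *)
Lemma is_nth_elt_exists (S : set nat) :
  (forall n, exists x, (n < count_below S x)%N) -> forall n, exists x, is_nth_elt S n x.
Proof.
move=> unb n; case: (ex_minnP (unb n)) => -[//|x] nx minx; exists x.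
have cx : (count_below S x <= n)%N by rewrite leqNgt; apply/negP => /minx; rewrite ltnn.
move: nx; rewrite count_belowS; case: (boolP (x \in S)) => [/set_mem Sx|_].
  by rewrite addn1 ltnS => nx; split=> //; apply/eqP; rewrite eqn_leq cx nx.
by rewrite addn0 ltnNge cx.
Qed.

Lemma in_triangle (B A : set nat) x : (B ▷ A) x <-> A x /\ B (count_below A x).
Proof.
split=> [[n [b [[Bb _] [Ax cb]]]]|[Ax Bx]]; first by rewrite cb.
by exists (count_below B (count_below A x)), (count_below A x).
Qed.

(** Both sides grow at the same places: [n] joins [C ▷ S] exactly when it lies in [S] and its rank
    in [S] lies in [C]. *)
Lemma count_below_triangle (C S : set nat) n :
  count_below (C ▷ S) n = count_below C (count_below S n).
Proof.
elim: n => // n IHn; rewrite !count_belowS {}IHn.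
have -> : (n \in C ▷ S) = (n \in S) && (count_below S n \in C).
  by apply/idP/andP; rewrite !inE => /in_triangle.
by case: (n \in S); rewrite ?addn0 //= addn1 count_belowS.
Qed.

Section Density.
Variable R : realType.
Local Open Scope ring_scope.

(** The quotients are squeezed between 0 and [N / n]. *)
Lemma has_density_bounded (S : set nat) (gamma : R) N :
  (forall x, (count_below S x <= N)%N) -> has_density S gamma -> gamma = 0.
Proof.
move=> SN Sg.
(* [harmonic] is the inverse of [n + 1], hence the shift. *)
have inv0 : (n%:R^-1 : R) @[n --> \oo] --> (0 : R).
  by rewrite -cvg_shiftS; exact: cvg_harmonic.
suff S0 : has_density S (0 : R) by exact: cvg_unique Sg S0.
apply: (@squeeze_cvgr _ _ _ _ (fun=> 0) (fun n => N%:R * n%:R^-1)).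
- by near=> n; rewrite divr_ge0 //= ler_wpM2r ?invr_ge0 // ler_nat.
- exact: cvg_cst.
- by rewrite -[X in _ --> X](mulr0 N%:R); apply: cvgMr.
Unshelve. all: by end_near. Qed.

Lemma has_density0_subset (S T : set nat) :
  S `<=` T -> has_density T (0 : R) -> has_density S (0 : R).
Proof.
move=> ST T0.
apply: (@squeeze_cvgr _ _ _ _ (fun=> 0) (fun n => (count_below T n)%:R / n%:R)) => //.
- near=> n; rewrite divr_ge0 //= ler_wpM2r ?invr_ge0 // ler_nat.
  exact: subset_count_below.
- exact: cvg_cst.
Unshelve. all: by end_near. Qed.

(** With [m = count_below S n], the quotient at [n] is that of [S] at [n] times that of [C] at [m],
    and [m] tends to infinity with [n]. *)
Lemma has_density_triangle (C S : set nat) (alpha beta : R) :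
  (forall n, exists x, (n < count_below S x)%N) ->
  has_density S alpha -> has_density C beta -> has_density (C ▷ S) (alpha * beta).
Proof.
move=> unb Sa Cb; rewrite /has_density.
have Soo : count_below S n @[n --> \oo] --> \oo.
  move=> P [N _ NP]; have [x Nx] := unb N; exists x => // n /= xn.
  by apply: NP => /=; rewrite (leq_trans (ltnW Nx)) // leq_count_below.
have -> : (fun n => (count_below (C ▷ S) n)%:R / n%:R) =
    (fun n => ((count_below S n)%:R / n%:R) *
      ((count_below C (count_below S n))%:R / (count_below S n)%:R)) :> (nat -> R).
  apply/funext => n; rewrite count_below_triangle.
  (* When the count is 0 nothing can be cancelled, but the numerators on both sides vanish. *)
  have [->|m0] := eqVneq (count_below S n) 0%N; first by rewrite !mul0r.
  by rewrite [RHS]mulrC mulrA divfK ?pnatr_eq0.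
by apply: cvgM => //; exact: (cvg_comp _ _ Soo Cb).
Qed.

End Density.

(** * The permutation of ranks induced by [pi] *)

Section RankPermutation.
Variables (A : set nat) (pi a c : nat -> nat).
Hypothesis pi_bij : bijective pi.
Hypothesis a_nth : forall n, is_nth_elt A n (a n).
Hypothesis c_nth : forall n, is_nth_elt (pi @` A) n (c n).

(** This is the permutation [sigma] with [pi (a n) = c (sigma n)]. *)
Definition rank_perm (n : nat) : nat := count_below (pi @` A) (pi (a n)).

(** The inverse is the same construction with [A] and its image exchanged and [pi] inverted. *)
Lemma rank_perm_bij : bijective rank_perm.
Proof.
have [pi' piK pi'K] := pi_bij.
exists (fun m => count_below A (pi' (c m))) => [n|m].
- have [Aa an] := a_nth n; rewrite -[RHS]an; congr (count_below A _).
  rewrite -[RHS]piK; congr pi'.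
  apply: (@is_nth_elt_uniq (pi @` A) (rank_perm n)); first exact: c_nth.
  by split=> //; exists (a n).
- have [[x Ax xc] cm] := c_nth m; rewrite -[RHS]cm /rank_perm -xc piK.
  congr (count_below _ (pi _)).
  exact: is_nth_elt_uniq (a_nth _) _.
Qed.

Lemma image_triangle (B : set nat) : pi @` (B ▷ A) = (rank_perm @` B) ▷ (pi @` A).
Proof.
(* An element [x] of [A] equals [a (count_below A x)], by uniqueness of the element of given
   index. *)
have rank_count x : A x -> rank_perm (count_below A x) = count_below (pi @` A) (pi x).
  move=> Ax; congr (count_below _ (pi _)).
  exact: is_nth_elt_uniq (a_nth _) _.
apply/seteqP; split=> [_ [x /in_triangle[Ax Bx] <-]|y /in_triangle[[x Ax <-] [b Bb]]].
- apply/in_triangle; split; first by exists x.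
  by exists (count_below A x) => //; rewrite rank_count.
(* Injectivity of [rank_perm] identifies [b] with the rank of [x] in [A]. *)
- rewrite -rank_count // => /(bij_inj rank_perm_bij) bE.
  by exists x => //; apply/in_triangle; rewrite -bE.
Qed.

(** Membership of [x] in the image of [A] is decided by asking the oracle about the preimage
    [pi' x], found by search; [a] is enumerated directly from the oracle. *)
Lemma computable_in_rank_perm : computable pi -> computable_in A rank_perm.
Proof.
move=> /(@computable_computable_in A) cpi; have [pi' piK pi'K] := pi_bij.
apply: (@computable_in_comp _ (count_below (pi @` A)) (pi \o a)).
- apply: computable_in_count_below.
  have -> : (fun x => (x \in pi @` A) : nat) = (fun x => (x \in A) : nat) \o pi'.
    apply/funext => x /=; congr nat_of_bool; apply/idP/idP; rewrite !inE.
    + by move=> [y Ay <-]; rewrite piK.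
    + by move=> Ax; exists (pi' x); rewrite ?pi'K.
  apply: computable_in_comp; first exact: computable_in_mem.
  exact: computable_in_inv piK pi'K cpi.
- apply: computable_in_comp => //.
  exact: computable_in_nth_elt (@computable_in_mem A) a_nth.
Qed.

End RankPermutation.

(** * Intrinsic density of [B ▷ A]: finite and infinite cases *)

Local Open Scope ring_scope.

Theorem theorem3p4 (R : realType) (A B : set nat) (alpha beta : R)
  (hA : has_intrinsic_density A alpha)
  (hB : has_rel_intrinsic_density A B beta) :
  has_intrinsic_density (B ▷ A) (alpha * beta).
Proof.
move=> pi pi_bij cpi; have dpiA := hA pi pi_bij cpi.
(* The identity permutation yields the plain density of [A]. *)
have dA : has_density A alpha.
  have id_bij : bijective (@id nat) by exists id.
  by have := hA id id_bij computable_id; rewrite image_id.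
have small : alpha = 0 -> has_density (pi @` (B ▷ A)) (alpha * beta).
  move=> a0; move: dpiA; rewrite a0 mul0r; apply: has_density0_subset.
  by apply: image_subset => x /in_triangle[].
(* A bounded count forces density 0, the case settled by [small]; otherwise [A] and its image both
   have unbounded counts and can be enumerated by [a] and [c]. *)
have zero_or_unbounded (S : set nat) : has_density S alpha ->
    alpha = 0 \/ forall n, exists x, (n < count_below S x)%N.
  move=> dS; have [unb|/existsNP[N bnd]] :=
    pselect (forall n, exists x, (n < count_below S x)%N); first by right.
  left; apply: (has_density_bounded (N := N)) dS => x.
  by rewrite leqNgt; apply/negP => Nx; apply: bnd; exists x.
have [//|unbA] := zero_or_unbounded _ dA; have [//|unbS] := zero_or_unbounded _ dpiA.
have [a a_nth] := choice (is_nth_elt_exists unbA).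
have [c c_nth] := choice (is_nth_elt_exists unbS).
rewrite (image_triangle pi_bij a_nth c_nth).
apply: has_density_triangle => //; apply: hB.
- exact: rank_perm_bij pi_bij a_nth c_nth.
- exact: computable_in_rank_perm.
Qed.
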